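(* Let $n\in\mathbb N$ and let $S\subset\mathbb R^n$ be a nondegenerate $n$-dimensional simplex. If $S\subset B_n$, then $\xi(B_n;S)\ge n$. Moreover (for $S\subset B_n$), the equality $\xi(B_n;S)=n$ holds if and only if $S$ is a regular simplex inscribed into $B_n$.
   Context: $B_n=\{x\in\mathbb R^n:\|x\|\le 1\}$ is the closed Euclidean unit ball. For a nondegenerate simplex $S\subset\mathbb R^n$, $\tau S$ denotes the image of $S$ under the homothety with center at the center of gravity of $S$ and ratio $\tau$. For a convex body $C\subset\mathbb R^n$, the absorption index is $\xi(C;S)=\min\{\sigma\ge 1: C\subset\sigma S\}$. A simplex is inscribed into a ball if all of its vertices lie on the boundary sphere of the ball; a simplex is regular if all its edges have equal length. *)

(* Defs.v *)
From mathcomp Require Import all_boot all_order all_algebra.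
From mathcomp Require Import boolp classical_sets reals.

Set Implicit Arguments.
Unset Strict Implicit.
Unset Printing Implicit Defensive.

Import Order.TTheory GRing.Theory Num.Theory.

Local Open Scope classical_set_scope.
Local Open Scope ring_scope.

(* The norm [`|x|] that MathComp-Analysis puts on 'rV[R]_n is the sup norm,
   hence a separate Euclidean norm. *)
Definition enorm (R : realType) (n : nat) (x : 'rV[R]_n) : R :=
  Num.sqrt (\sum_(i < n) x 0 i ^+ 2).

Definition eball (R : realType) (n : nat) : set 'rV[R]_n :=
  [set x | enorm x <= 1].

Arguments eball : clear implicits.

Definition affinely_independent (R : realType) (n k : nat)
    (v : 'I_k -> 'rV[R]_n) : Prop :=
  forall a : 'I_k -> R,
    \sum_i a i = 0 -> \sum_i a i *: v i = 0 -> forall i, a i = 0.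

(* A nondegenerate simplex of R^n is given by its n + 1 vertices [v];
   [simplex v] is the underlying set, the convex hull of the vertices. *)
Definition nondegenerate_simplex (R : realType) (n : nat)
    (v : 'I_n.+1 -> 'rV[R]_n) : Prop := affinely_independent v.

Definition simplex (R : realType) (n : nat) (v : 'I_n.+1 -> 'rV[R]_n) :
    set 'rV[R]_n :=
  [set x | exists a : 'I_n.+1 -> R,
     [/\ forall i, 0 <= a i, \sum_i a i = 1 & x = \sum_i a i *: v i]].

Definition center_of_gravity (R : realType) (n : nat)
    (v : 'I_n.+1 -> 'rV[R]_n) :
    'rV[R]_n :=
  n.+1%:R^-1 *: \sum_i v i.

Definition homothety (R : realType) (n : nat) (c : 'rV[R]_n) (tau : R)
    (x : 'rV[R]_n) : 'rV[R]_n :=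
  c + tau *: (x - c).

Definition dilate (R : realType) (n : nat) (tau : R)
    (v : 'I_n.+1 -> 'rV[R]_n) : set 'rV[R]_n :=
  homothety (center_of_gravity v) tau @` simplex v.

(* The least element of [A]; the value is the dummy 0 if there is none. *)
Definition set_min (R : realType) (A : set R) : R :=
  xget 0 [set m | A m /\ lbound A m].

(* For a convex body [C] and a nondegenerate simplex the minimum exists and is
   at least 1, so the dummy value 0 of [set_min] does not occur. *)
Definition absorption_index (R : realType) (n : nat) (C : set 'rV[R]_n)
    (v : 'I_n.+1 -> 'rV[R]_n) : R :=
  set_min [set sigma : R | 1 <= sigma /\ C `<=` dilate sigma v].

Definition regular_simplex (R : realType) (n : nat)
    (v : 'I_n.+1 -> 'rV[R]_n) : Prop :=
  forall i j k l : 'I_n.+1, i != j -> k != l ->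
    enorm (v i - v j) = enorm (v k - v l).

Definition inscribed_in_ball (R : realType) (n : nat)
    (v : 'I_n.+1 -> 'rV[R]_n) : Prop :=
  forall i, enorm (v i) = 1.

(* Main.v *)
(** Write the barycentric coordinates of [x] as [b_i + <l_i, x>].  Since
    [sigma S] is cut out by [b_i + <l_i, x> >= (1 - sigma) / (n + 1)], the ball
    lies in [sigma S] iff [sigma >= 1 + (n + 1) (|l_i| - b_i)] for all [i].
    Averaging over [i] and using [\sum b_i = 1] gives [sigma >= \sum |l_i|],
    while [\sum |l_i| >= \sum <l_i, v_i> = \sum (1 - b_i) = n].  Equality forces
    [|v_i| = 1], [l_i = |l_i| v_i] and all [|l_i| - b_i] equal, whence
    [b_i = 1 / (n + 1)], [|l_i| = n / (n + 1)] and [<v_i, v_j> = - 1 / n];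
    conversely these are the barycentric coordinates of a regular inscribed
    simplex. *)
Require Import Defs.
From mathcomp Require Import all_boot all_order all_algebra.
From mathcomp Require Import boolp classical_sets reals.
From mathcomp Require Import ring lra.

Set Implicit Arguments.
Unset Strict Implicit.
Unset Printing Implicit Defensive.

Import Order.TTheory GRing.Theory Num.Theory.

Local Open Scope classical_set_scope.
Local Open Scope ring_scope.

(** * Euclidean inner product and Cauchy-Schwarz against the unit ball, with its equality case *)

Section Euclidean.
Context (R : realType) (n : nat).
Implicit Types x y z : 'rV[R]_n.

Definition dot x y : R := \sum_(i < n) x 0 i * y 0 i.

Lemma dotC x y : dot x y = dot y x.
Proof. by apply: eq_bigr => i _; rewrite mulrC. Qed.

Lemma dotDl x y z : dot (x + y) z = dot x z + dot y z.
Proof. by rewrite -big_split; apply: eq_bigr => i _; rewrite mxE mulrDl. Qed.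

Lemma dotZl k x y : dot (k *: x) y = k * dot x y.
Proof. by rewrite mulr_sumr; apply: eq_bigr => i _; rewrite mxE mulrA. Qed.

Lemma dotDr x y z : dot x (y + z) = dot x y + dot x z.
Proof. by rewrite !(dotC x) dotDl. Qed.

Lemma dotZr k x y : dot x (k *: y) = k * dot x y.
Proof. by rewrite !(dotC x) dotZl. Qed.

Lemma dotBl x y z : dot (x - y) z = dot x z - dot y z.
Proof. by rewrite -scaleN1r dotDl dotZl mulN1r. Qed.

Lemma dotBr x y z : dot x (y - z) = dot x y - dot x z.
Proof. by rewrite !(dotC x) dotBl. Qed.

Lemma dot0r x : dot x 0 = 0.
Proof. by rewrite -(scale0r 0) dotZr mul0r. Qed.

Lemma dot_sumr (I : finType) x (f : I -> 'rV[R]_n) :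
  dot x (\sum_i f i) = \sum_i dot x (f i).
Proof. by apply: (big_morph _ (dotDr x)); rewrite dot0r. Qed.

Lemma dot_suml (I : finType) (f : I -> 'rV[R]_n) x :
  dot (\sum_i f i) x = \sum_i dot (f i) x.
Proof. by rewrite dotC dot_sumr; apply: eq_bigr => i _; rewrite dotC. Qed.

Lemma dotxx_ge0 x : 0 <= dot x x.
Proof. by apply: sumr_ge0 => i _; rewrite -expr2 sqr_ge0. Qed.

Lemma dotxx_eq0 x : dot x x = 0 -> x = 0.
Proof.
move=> x0; apply/rowP => i; apply/eqP; rewrite mxE.
have /psumr_eq0P/(_ x0 i isT)/eqP : forall i, true -> 0 <= x 0 i * x 0 i.
  by move=> j _; rewrite -expr2 sqr_ge0.
by rewrite mulf_eq0 orbb.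
Qed.

Lemma enormE x : enorm x = Num.sqrt (dot x x).
Proof. by congr Num.sqrt; apply: eq_bigr => i _; rewrite expr2. Qed.

Lemma enorm_ge0 x : 0 <= enorm x.
Proof. by rewrite sqrtr_ge0. Qed.

Lemma sqr_enorm x : enorm x ^+ 2 = dot x x.
Proof. by rewrite enormE sqr_sqrtr ?dotxx_ge0. Qed.

Lemma enorm_eq0 x : enorm x = 0 -> x = 0.
Proof. by move=> x0; apply: dotxx_eq0; rewrite -sqr_enorm x0 expr0n. Qed.

Lemma enormZ k x : enorm (k *: x) = `|k| * enorm x.
Proof.
by rewrite !enormE dotZl dotZr mulrA -expr2 sqrtrM ?sqr_ge0// sqrtr_sqr.
Qed.

Lemma sqr_enormB x y :
  enorm (x - y) ^+ 2 = enorm x ^+ 2 - 2 * dot x y + enorm y ^+ 2.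
Proof. by rewrite !sqr_enorm dotBl !dotBr (dotC y x); ring. Qed.

(** For [enorm y <= 1] both terms on the left are nonnegative. So this identity yields the bound
    [dot x y <= enorm x] after division by [2 * enorm x], and in the equality case both terms must
    vanish. *)
Lemma dot_ball_gap x y :
  enorm (x - enorm x *: y) ^+ 2 + enorm x ^+ 2 * (1 - enorm y ^+ 2) =
  2 * enorm x * (enorm x - dot x y).
Proof. by rewrite sqr_enormB dotZr enormZ ger0_norm ?enorm_ge0//; ring. Qed.

Lemma dot_ball_le x y : enorm y <= 1 -> dot x y <= enorm x.
Proof.
move=> y1; have [x0|x_neq0] := eqVneq (enorm x) 0.
  by rewrite (enorm_eq0 x0) dotC dot0r enorm_ge0.
have x_gt0 : 0 < enorm x by rewrite lt0r x_neq0 enorm_ge0.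
have ysq : 0 <= 1 - enorm y ^+ 2 by rewrite subr_ge0 expr_le1 ?enorm_ge0.
rewrite -subr_ge0 -(pmulr_rge0 _ (mulr_gt0 (ltr0Sn R 1) x_gt0)) -dot_ball_gap.
by apply: addr_ge0; [|apply: mulr_ge0]; rewrite ?sqr_ge0.
Qed.

Lemma dot_ball_eq x y : enorm y <= 1 -> x != 0 -> dot x y = enorm x ->
  enorm y = 1 /\ x = enorm x *: y.
Proof.
move=> y1 x_neq0 xy; have x_gt0 : 0 < enorm x.
  by rewrite lt0r enorm_ge0 andbT; apply: contraNneq x_neq0 => /enorm_eq0 ->.
have ysq : 0 <= 1 - enorm y ^+ 2 by rewrite subr_ge0 expr_le1 ?enorm_ge0.
have := dot_ball_gap x y; rewrite xy subrr mulr0 => /eqP.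
rewrite paddr_eq0 ?(mulr_ge0 _ ysq) ?sqr_ge0// sqrf_eq0 mulf_eq0 sqrf_eq0.
rewrite (gt_eqF x_gt0) subr_eq0 => /andP[/eqP/enorm_eq0/eqP].
rewrite subr_eq0 => /eqP xE y2; split=> //.
by apply/eqP; rewrite -sqrp_eq1 ?enorm_ge0// eq_sym.
Qed.

End Euclidean.

Lemma set_minE (R : realType) (A : set R) m : A m -> lbound A m -> set_min A = m.
Proof.
move=> Am lbm; apply: xget_subset1 => // p q [Ap lbp] [Aq lbq].
by apply/eqP; rewrite eq_le lbp ?lbq.
Qed.

(** * Barycentric coordinates as affine functions on the whole space *)

Section Barycentric.
Context (R : realType) (n : nat).
Implicit Types (v l : 'I_n.+1 -> 'rV[R]_n) (b : 'I_n.+1 -> R).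

(** [b i] is the value of the [i]-th coordinate at the origin and [l i] its gradient. *)
Definition barycentric v b l := forall x,
  \sum_i (b i + dot (l i) x) = 1 /\ \sum_i (b i + dot (l i) x) *: v i = x.

(** Affine independence says that the matrix [M] with rows [(1, v i)] has trivial left kernel, so it
    is invertible. The coordinates of [x] are [(1, x)] times the inverse: its first row gives [b],
    the other rows give [l]. *)
Lemma barycentric_exists v : affinely_independent v ->
  exists b l, barycentric v b l.
Proof.
move=> v_indep.
pose M : 'M[R]_(1 + n) := \matrix_i row_mx (1 : 'M_1) (v i).
have M0 i j : M i (lshift n j) = 1 by rewrite mxE row_mxEl mxE ord1 eqxx.
have MS i k : M i (rshift 1 k) = v i 0 k by rewrite mxE row_mxEr.
have ML (w : 'rV_(1 + n)) : (w *m M) 0 (lshift n 0) = \sum_i w 0 i.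
  by rewrite mxE; apply: eq_bigr => i _; rewrite M0 mulr1.
have MR (w : 'rV_(1 + n)) k :
    (w *m M) 0 (rshift 1 k) = (\sum_i w 0 i *: v i) 0 k.
  by rewrite mxE summxE; apply: eq_bigr => i _; rewrite MS mxE.
have M_unit : M \in unitmx.
  rewrite -row_free_unit; apply: inj_row_free => w wM0.
  apply/rowP => i; rewrite mxE; apply: (v_indep (fun i => w 0 i)).
    by rewrite -ML wM0 mxE.
  by apply/rowP => k; rewrite -MR wM0 !mxE.
pose N := invmx M.
exists (fun i => N (lshift n 0) i), (fun i => \row_k N (rshift 1 k) i) => x.
have NE i : N (lshift n 0) i + dot (\row_k N (rshift 1 k) i) x =
    (row_mx 1 x *m N) 0 i.
  rewrite mxE big_split_ord /= big_ord1 row_mxEl mxE mul1r; congr (_ + _).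
  by apply: eq_bigr => k _; rewrite row_mxEr mxE mulrC.
under eq_bigr => i _ do rewrite NE.
under [X in _ /\ X = _]eq_bigr => i _ do rewrite NE.
split; first by rewrite -ML mulmxKV// row_mxEl mxE.
by apply/rowP => k; rewrite -MR mulmxKV// row_mxEr.
Qed.

Lemma affine_coord_unique v a a' : affinely_independent v ->
  \sum_i a i = \sum_i a' i -> \sum_i a i *: v i = \sum_i a' i *: v i ->
  a =1 a'.
Proof.
move=> v_indep sa sv i; apply/eqP; rewrite -subr_eq0; apply/eqP.
apply: (v_indep (fun i => a i - a' i)); first by rewrite sumrB sa subrr.
by under eq_bigr => j _ do rewrite scalerBl; rewrite sumrB sv subrr.
Qed.

Lemma sum_delta (j : 'I_n.+1) : \sum_i (i == j)%:R = 1 :> R.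
Proof. by rewrite (bigD1 j)//= eqxx big1 ?addr0// => i /negPf ->. Qed.

Lemma sum_delta_scale v j : \sum_i (i == j)%:R *: v i = v j.
Proof.
by rewrite (bigD1 j)//= eqxx scale1r big1 ?addr0// => i /negPf ->; rewrite scale0r.
Qed.

Lemma vertex_in_simplex v j : simplex v (v j).
Proof.
exists (fun i => (i == j)%:R); split; rewrite ?sum_delta ?sum_delta_scale//.
Qed.

(** All coordinates of the center of gravity are [1 / (n + 1)], so the homothety scales each
    coordinate separately about that value. *)
Lemma homothety_affine_comb v tau (a : 'I_n.+1 -> R) :
  homothety (center_of_gravity v) tau (\sum_i a i *: v i) =
  \sum_i (n.+1%:R^-1 + tau * (a i - n.+1%:R^-1)) *: v i.
Proof.
rewrite /homothety /center_of_gravity scaler_sumr -sumrB scaler_sumr -big_split /=.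
by apply: eq_bigr => i _; rewrite -scalerBl scalerA -scalerDl.
Qed.

Lemma sum_homothety_coord tau (a : 'I_n.+1 -> R) : \sum_i a i = 1 ->
  \sum_i (n.+1%:R^-1 + tau * (a i - n.+1%:R^-1)) = 1.
Proof.
move=> a1; have k1 : \sum_(i < n.+1) n.+1%:R^-1 = 1 :> R.
  by rewrite sumr_const card_ord -[LHS]mulr_natr mulVf// pnatr_eq0.
by rewrite big_split /= -mulr_sumr sumrB a1 k1 subrr mulr0 addr0.
Qed.

Lemma sumr_le_eq (I : finType) (f g : I -> R) : (forall i, f i <= g i) ->
  \sum_i g i <= \sum_i f i -> f =1 g.
Proof.
move=> fg sgf i; apply/eqP; rewrite eq_sym -subr_eq0; apply/eqP.
apply: (@psumr_eq0P _ _ predT (fun i => g i - f i)) => //.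
  by move=> j _; rewrite subr_ge0.
by apply/eqP; rewrite sumrB subr_eq0 eq_le sgf ler_sum.
Qed.

(** * Inclusion of the ball in a dilated simplex, read off the coordinates *)

Section Coordinates.
Variables (v l : 'I_n.+1 -> 'rV[R]_n) (b : 'I_n.+1 -> R).
Hypotheses (v_indep : affinely_independent v) (vbl : barycentric v b l).

Lemma barycentric_comb (a : 'I_n.+1 -> R) i : \sum_j a j = 1 ->
  b i + dot (l i) (\sum_j a j *: v j) = a i.
Proof.
move=> a1; have [s1 sv] := vbl (\sum_j a j *: v j).
pose c j := b j + dot (l j) (\sum_j a j *: v j).
by apply: (@affine_coord_unique v c a v_indep); rewrite ?s1 ?sv.
Qed.

Lemma barycentric_vertex i j : b i + dot (l i) (v j) = (i == j)%:R.
Proof.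
by rewrite -(sum_delta_scale v j) (barycentric_comb _ (sum_delta j)).
Qed.

Lemma sum_barycentric0 : \sum_i b i = 1.
Proof.
by have [<- _] := vbl 0; apply: eq_bigr => i _; rewrite dot0r addr0.
Qed.

Lemma sum_dot_vertex : \sum_i dot (l i) (v i) = n%:R.
Proof.
have : \sum_i (b i + dot (l i) (v i)) = n.+1%:R.
  under eq_bigr => i _ do rewrite barycentric_vertex eqxx.
  by rewrite sumr_const card_ord.
by rewrite big_split /= sum_barycentric0 -nat1r => /addrI.
Qed.

(* The least [sigma] for which the ball lies on the inner side of the
   [i]-th facet of [sigma S]. *)
Definition facet_index b l i : R := 1 + n.+1%:R * (enorm (l i) - b i).

Lemma ball_sub_dilate sigma : 1 <= sigma ->
  eball R n `<=` dilate sigma v <-> forall i, facet_index b l i <= sigma.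
Proof.
move=> sigma1; set N : R := n.+1%:R.
have N0 : 0 < N by rewrite ltr0n.
have sigma0 : 0 < sigma by rewrite (lt_le_trans ltr01).
split=> [sub i|facet_le x x1].
  (* The point of the ball where the [i]-th coordinate is least. If [l i = 0], the convention
     [0^-1 = 0] gives [x = 0], which serves as well. *)
  pose x := (- (enorm (l i))^-1) *: l i.
  have x1 : enorm x <= 1.
    rewrite enormZ normrN normfV ger0_norm ?enorm_ge0//.
    by have [->|/mulVf ->//] := eqVneq (enorm (l i)) 0; rewrite mulr0 ler01.
  have lx : dot (l i) x = - enorm (l i).
    rewrite dotZr -sqr_enorm mulNr expr2 mulrA.
    have [->|/mulVf ->] := eqVneq (enorm (l i)) 0; last by rewrite mul1r.
    by rewrite mulr0.
  have [_ [a [a_ge0 a1 ->]]] := sub _ x1.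
  rewrite homothety_affine_comb => xE.
  have := barycentric_comb i (sum_homothety_coord sigma a1).
  rewrite xE lx -/N => bE; rewrite /facet_index -/N.
  have -> : enorm (l i) - b i = - (N^-1 + sigma * (a i - N^-1)).
    by rewrite -bE; ring.
  have -> : 1 + N * - (N^-1 + sigma * (a i - N^-1)) = sigma - N * sigma * a i.
    by clearbody N; field; rewrite gt_eqF.
  by rewrite gerBl !mulr_ge0 ?(ltW N0) ?(ltW sigma0).
have [s1 sx] := vbl x.
(* The coordinates of the preimage of [x] under the homothety; the facet condition makes them
   nonnegative. *)
pose c i := N^-1 + sigma^-1 * (b i + dot (l i) x - N^-1).
exists (\sum_i c i *: v i).
  exists c; split=> //; last exact: sum_homothety_coord.
  move=> i; have Nx1 : enorm (- x) <= 1.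
    by rewrite -scaleN1r enormZ normrN1 mul1r.
  have := dot_ball_le (l i) Nx1; rewrite -scaleN1r dotZr mulN1r => lx.
  rewrite -(pmulr_rge0 _ (mulr_gt0 N0 sigma0)).
  have -> : N * sigma * c i = sigma - 1 + N * (b i + dot (l i) x).
    by rewrite /c; clearbody N; field; rewrite !gt_eqF.
  have := facet_le i; rewrite /facet_index -/N; clearbody N.
  have : N * (- dot (l i) x) <= N * enorm (l i) by rewrite ler_pM2l.
  by lra.
rewrite homothety_affine_comb -[RHS]sx; apply: eq_bigr => i _; congr (_ *: _).
by rewrite /c -/N; clearbody N; field; rewrite !gt_eqF.
Qed.

(** The default value 1 of the maximum accounts for the constraint [1 <= sigma]. *)
Lemma absorption_index_ball :
  absorption_index (eball R n) v = \big[Num.max/1]_i facet_index b l i.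
Proof.
have m1 : 1 <= \big[Num.max/1]_i facet_index b l i by apply: bigmax_ge_id.
apply: set_minE => [|sigma [sigma1 /(ball_sub_dilate sigma1) le_sigma]].
  by split=> //; apply/(ball_sub_dilate m1) => i; apply: le_bigmax.
by apply: bigmax_le.
Qed.

Lemma sum_facet_index :
  \sum_i facet_index b l i = n.+1%:R * \sum_i enorm (l i).
Proof.
rewrite big_split /= -mulr_sumr sumrB sum_barycentric0 sumr_const card_ord /=.
by rewrite mulrBr mulr1 addrC subrK.
Qed.

(** * Simplices with vertices in the ball: the lower bound and its extremal case *)

Hypothesis v_ball : forall i, enorm (v i) <= 1.

Lemma sum_enorm_ge : n%:R <= \sum_i enorm (l i).
Proof. by rewrite -sum_dot_vertex; apply: ler_sum => i _; apply: dot_ball_le. Qed.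

Lemma absorption_index_ball_ge : n%:R <= absorption_index (eball R n) v.
Proof.
apply: (le_trans sum_enorm_ge).
rewrite -(ler_pM2l (ltr0Sn R n)) -sum_facet_index absorption_index_ball.
rewrite mulr_natl -[X in _ *+ X](card_ord n.+1) -sumr_const.
by apply: ler_sum => i _; apply: le_bigmax.
Qed.

(** When the index is [n], the facet indices are at most [n] with sum at least [(n + 1) n], and
    [<l_i, v_i> <= |l_i|] with equal sums. Both inequalities are therefore equalities for every
    [i]. *)
Lemma barycentric_extremal : (0 < n)%N ->
    absorption_index (eball R n) v = n%:R ->
  forall i, enorm (v i) = 1 /\ forall j, i != j -> dot (v i) (v j) = - n%:R^-1.
Proof.
move=> n_gt0 absn i.
have facet_le j : facet_index b l j <= n%:R.
  by rewrite -absn absorption_index_ball; apply: le_bigmax.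
have sumn : \sum_(j < n.+1) n%:R = n.+1%:R * n%:R :> R.
  by rewrite sumr_const card_ord mulr_natl.
have facetE : facet_index b l i = n%:R.
  apply: (@sumr_le_eq _ (facet_index b l) (fun=> n%:R)) => //.
  by rewrite sumn sum_facet_index ler_pM2l ?ltr0Sn// sum_enorm_ge.
have dotE : dot (l i) (v i) = enorm (l i).
  apply: (@sumr_le_eq _ (fun i => dot (l i) (v i)) (fun i => enorm (l i))).
    by move=> j; apply: dot_ball_le.
  rewrite sum_dot_vertex -(ler_pM2l (ltr0Sn R n)) -sum_facet_index -sumn.
  by apply: ler_sum.
(* Otherwise the [i]-th coordinate would be constant, yet it is 1 at [v i] and 0 at another vertex,
   which exists since [0 < n]. *)
have l_neq0 : l i != 0.
  apply/eqP => li0; have := barycentric_vertex i (lift i (Ordinal n_gt0)).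
  have := barycentric_vertex i i.
  rewrite eqxx (negPf (neq_lift _ _)) li0 !(dotC 0) !dot0r => ->.
  by move/eqP; rewrite oner_eq0.
have [v1 lE] := dot_ball_eq (v_ball i) l_neq0 dotE.
split=> // j ij; have := barycentric_vertex i j; rewrite (negPf ij) lE dotZl.
have := barycentric_vertex i i; rewrite eqxx dotE; move: facetE.
rewrite /facet_index -nat1r; set L := enorm (l i); set d := dot _ _.
have : 0 < n%:R :> R by rewrite ltr0n.
move: n%:R => N N0 facetE bL bd.
have bE : b i = 1 - L := canRL (addrK L) bL.
have LE : (1 + N) * L = N by move: facetE; rewrite bE; lra.
(* Here [(1 + N) * L = N] and [(1 + N) * b i = 1]; the right-hand side vanishes because the [i]-th
   coordinate of [v j] is 0. *)
have Nd : 1 + N * d = (1 + N) * (b i + L * d).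
  by rewrite bE mulrDr mulrBr mulr1 mulrA LE; ring.
apply: (mulfI (lt0r_neq0 N0)); rewrite mulrN mulfV ?lt0r_neq0//.
by apply/eqP; rewrite -addr_eq0 addrC Nd bd mulr0.
Qed.

End Coordinates.
End Barycentric.

(** * Regular inscribed simplices attain the bound *)

Section RegularInscribed.
Variables (R : realType) (n : nat) (v : 'I_n.+1 -> 'rV[R]_n).
Hypotheses (n_gt0 : (0 < n)%N) (v_indep : affinely_independent v).
Hypotheses (v_reg : regular_simplex v) (v_ins : inscribed_in_ball v).

(** Equal edges between unit vectors force a common inner product [g]. Evaluating [<s, s>] in two
    ways gives [n (1 + n g) = 0]. *)
Lemma dot_regular_inscribed i j : i != j -> dot (v i) (v j) = - n%:R^-1.
Proof.
move=> ij; set g := dot _ _; pose s := \sum_k v k.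
have gE k m : k != m -> dot (v k) (v m) = g.
  move=> km; have := congr1 (fun x => x ^+ 2) (v_reg km ij).
  by rewrite !sqr_enormB !v_ins -/g; lra.
have vs k : dot (v k) s = 1 + n%:R * g.
  rewrite dot_sumr (bigD1 k)//= -sqr_enorm v_ins expr1n; congr (_ + _).
  under eq_bigr => m mk do rewrite gE 1?eq_sym//.
  by rewrite sumr_const cardC1 card_ord mulr_natl.
(* [s] is an affine combination of the [v k], all of which have the same inner
   product with it; summing these inner products also gives [<s, s>]. *)
have [b [l vbl]] := barycentric_exists v_indep.
have [a1 as_] := vbl s.
have ss : dot s s = 1 + n%:R * g.
  rewrite -{1}as_ dot_suml; under eq_bigr => k _ do rewrite dotZl vs.
  by rewrite -mulr_suml a1 mul1r.
have ss' : dot s s = n.+1%:R * (1 + n%:R * g).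
  rewrite {1}/s dot_suml; under eq_bigr => k _ do rewrite vs.
  by rewrite sumr_const card_ord -[LHS]mulr_natl.
have N0 : n%:R != 0 :> R by rewrite pnatr_eq0 -lt0n.
apply: (mulfI N0); rewrite mulrN mulfV//.
apply/eqP; rewrite -addr_eq0 addrC -(mulrI_eq0 _ (mulfI N0)).
by move: ss'; rewrite ss -nat1r mulrDl mul1r -[LHS]addr0 => /addrI <-.
Qed.

(** If [x] has coordinates [a], then [<v_i, x> = a_i - (1 - a_i) / n]; solving for [a_i] gives the
    formula. *)
Lemma barycentric_regular_inscribed :
  barycentric v (fun=> n.+1%:R^-1) (fun i => (n%:R / n.+1%:R) *: v i).
Proof.
move=> x; have [b [l vbl]] := barycentric_exists v_indep.
have [a1 ax] := vbl x; set a := fun i => b i + dot (l i) x.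
have N0 : n%:R != 0 :> R by rewrite pnatr_eq0 -lt0n.
have S0 : n.+1%:R != 0 :> R by rewrite pnatr_eq0.
have aE i : n.+1%:R^-1 + dot ((n%:R / n.+1%:R) *: v i) x = a i.
  rewrite -ax dotZl dot_sumr (bigD1 i)//= dotZr -sqr_enorm v_ins expr1n mulr1.
  under eq_bigr => j ji do rewrite dotZr dot_regular_inscribed 1?eq_sym//.
  rewrite -mulr_suml -/(a i).
  have -> : \sum_(j | j != i) (b j + dot (l j) x) = 1 - a i.
    by move: a1; rewrite (bigD1 i)//= -/(a i) => <-; rewrite [RHS]addrC addKr.
  by move: N0 S0; rewrite -nat1r; move: n%:R => N N0 S0; field; rewrite N0 S0.
by split; under eq_bigr => i _ do rewrite aE.
Qed.

Lemma absorption_index_regular_inscribed :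
  absorption_index (eball R n) v = n%:R.
Proof.
have n1 : 1 <= n%:R :> R by rewrite ler1n.
have S0 : n.+1%:R != 0 :> R by rewrite pnatr_eq0.
have facetE i : facet_index (fun=> n.+1%:R^-1)
    (fun i => (n%:R / n.+1%:R) *: v i) i = n%:R.
  rewrite /facet_index enormZ v_ins ger0_norm ?divr_ge0 ?ler0n//.
  by move: S0; rewrite -nat1r; move: n%:R => N S0; field.
rewrite (absorption_index_ball v_indep barycentric_regular_inscribed).
under eq_bigr => i _ do rewrite facetE.
(* All facet indices equal [n], and the default 1 does not exceed [n]. *)
apply/eqP; rewrite eq_le bigmax_le//=.
exact: (@le_bigmax _ _ _ _ (fun=> n%:R) ord0).
Qed.

End RegularInscribed.

Theorem theorem4 (R : realType) (n : nat) (n_gt0 : (0 < n)%N)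
    (v : 'I_n.+1 -> 'rV[R]_n) (v_nondeg : nondegenerate_simplex v)
    (v_sub_ball : simplex v `<=` eball R n) :
  n%:R <= absorption_index (eball R n) v /\
  (absorption_index (eball R n) v = n%:R <->
     regular_simplex v /\ inscribed_in_ball v).
Proof.
have v_ball i : enorm (v i) <= 1 by apply/v_sub_ball/vertex_in_simplex.
have [b [l vbl]] := barycentric_exists v_nondeg.
split; first exact: (absorption_index_ball_ge v_nondeg vbl v_ball).
split=> [/(barycentric_extremal v_nondeg vbl v_ball n_gt0) ext|[v_reg v_ins]].
  split=> [i j k m ij km|i]; last by have [] := ext i.
  (* The extremal inner products determine every edge length: [1 + 2 / n + 1] squared units. *)
  have sqr_edge p q : p != q -> enorm (v p - v q) ^+ 2 = 2 + 2 / n%:R.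
    move=> pq; rewrite sqr_enormB; have [-> ->//] := ext p.
    by have [-> _] := ext q; ring.
  by apply/eqP; rewrite -(@eqrXn2 _ 2) ?enorm_ge0// !sqr_edge.
exact: absorption_index_regular_inscribed.
Qed.
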